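(* For every graph $\Gamma$, $F(\Gamma)$ is a unital, associative $*$-algebra and $t$ is a faithful, positive trace on $F(\Gamma)$.
   Context: Graphs. A graph $\Gamma$ means a finite, weighted, bipartite graph: a finite vertex set $V=V_0\sqcup V_1$, a finite set $E$ of oriented edges with start and finish maps $s,f:E\to V$ and a reversal involution $\xi\mapsto\tilde\xi$ of $E$ interchanging $s$ and $f$, such that $s(\xi)\in V_0\Leftrightarrow f(\xi)\in V_1$, and a weighting $\mu:V\to(0,\infty)$ with $\sum_{v\in V}\mu^2(v)=1$. A path $\xi$ of length $n\ge 0$ is $(v^\xi_0\xrightarrow{\xi_1}v^\xi_1\cdots\xrightarrow{\xi_n}v^\xi_n)$ with $\xi_i\in E$ an edge from $v^\xi_{i-1}$ to $v^\xi_i$; $s(\xi)=v_0^\xi$, $f(\xi)=v_n^\xi$; $\xi_{[i,j]}$ is the subpath from $v^\xi_i$ to $v^\xi_j$; $\tilde\xi$ is the reversed path. $P_n(\Gamma)$ is the complex vector space with basis $\{[\xi]:\xi\text{ a path of length }n\}$. $F(\Gamma)=\bigoplus_{n\ge0}P_n(\Gamma)$ as a vector space. Put $[\xi]\bullet[\eta]=[\xi\circ\eta]$ if $f(\xi)=s(\eta)$ and $0$ otherwise. For $1\le i<n$ let $S^n_i:P_n(\Gamma)\to P_{n-2}(\Gamma)$ be the linear map $S^n_i([\xi])=\delta_{\xi_i,\widetilde{\xi_{i+1}}}\frac{\mu(v^\xi_i)}{\mu(v^\xi_{i+1})}[\xi_{[0,i-1]}\circ\xi_{[i+1,n]}]$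 (note $v^\xi_{i-1}=v^\xi_{i+1}$ when this is non-zero). For $\xi,\eta$ of lengths $m,n$, $[\xi]\#[\eta]$ has components only in degrees $m+n-2k$, $0\le k\le\min\{m,n\}$, given by $[\xi]\bullet[\eta]$ for $k=0$ and by $$S_{m-k+1}^{m+n-2(k-1)}S_{m-k+2}^{m+n-2(k-2)}\cdots S^{m+n-2}_{m-1}S^{m+n}_m([\xi]\bullet[\eta])$$ for $k>0$. The involution is the conjugate-linear extension of $[\xi]^*=[\tilde\xi]$. The linear functional $t$ vanishes on $P_n(\Gamma)$ for $n\ge1$ and satisfies $t([(v)])=\mu^2(v)$ for $v\in V$. Positive means $t(x^*x)\ge0$ for all $x$; faithful means $t(x^*x)=0\Rightarrow x=0$. *)

(* Defs.v *)
(* Complex scalars are C = R[i] for R a realType, and free vector spaces on a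
   choiceType are the modules {malg C[K]} of finitely supported functions. *)
From HB Require Import structures.
From mathcomp Require Import all_boot all_order all_algebra.
From mathcomp Require Import finmap reals complex.
From mathcomp.multinomials Require Import monalg.

Set Implicit Arguments.
Unset Strict Implicit.
Unset Printing Implicit Defensive.

Import Order.TTheory GRing.Theory Num.Theory.
Local Open Scope ring_scope.

(* V_1 is the complement of [part0]. *)
Record graph (R : realType) := Graph {
  vertex : finType;
  edge : finType;
  part0 : {set vertex};
  esrc : edge -> vertex;
  etgt : edge -> vertex;
  erev : edge -> edge;
  mu : vertex -> R;
  erevK : involutive erev;
  esrc_erev : forall e, esrc (erev e) = etgt e;
  etgt_erev : forall e, etgt (erev e) = esrc e;
  bipartite : forall e, (esrc e \in part0) = (etgt e \in ~: part0);
  mu_gt0 : forall v, 0 < mu v;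
  mu_sum : \sum_v mu v ^+ 2 = 1
}.

Section Paths.
Context {R : realType} {G : graph R}.
Local Notation V := (vertex G).
Local Notation E := (edge G).

Fixpoint walk (v : V) (p : seq E) : bool :=
  if p is e :: p' then (esrc e == v) && walk (etgt e) p' else true.

Definition walk_end (v : V) (p : seq E) : V := last v (map (@etgt R G) p).

Lemma walk_cat v p q : walk v (p ++ q) = walk v p && walk (walk_end v p) q.
Proof. by elim: p v => //= e p IH v; rewrite IH andbA. Qed.

Lemma walk_rev v p : walk v p -> walk (walk_end v p) (rev (map (@erev R G) p)).
Proof.
elim: p v => //= e p IH v /andP[/eqP <- we].
rewrite rev_cons -cats1 walk_cat [walk_end _ _]/= -/(walk_end (etgt e) p) IH //=.
have -> : walk_end (walk_end (etgt e) p) (rev (map (@erev R G) p)) = etgt e.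
  case: p we {IH} => //= e' p /andP[/eqP <- _].
  by rewrite /walk_end rev_cons map_rcons last_rcons etgt_erev.
by rewrite esrc_erev eqxx.
Qed.

End Paths.

(* The initial vertex is recorded explicitly so that paths of length 0 are the
   vertices. *)
Record gpath (R : realType) (G : graph R) := GPath {
  pdata : vertex G * seq (edge G);
  pdataP : walk pdata.1 pdata.2
}.

HB.instance Definition _ (R : realType) (G : graph R) :=
  [isSub for @pdata R G].
HB.instance Definition _ (R : realType) (G : graph R) :=
  [Choice of gpath G by <:].

Section PathOps.
Context {R : realType} {G : graph R}.
Implicit Types xi eta : gpath G.

Definition pedges xi : seq (edge G) := (pdata xi).2.
Definition plen xi : nat := size (pedges xi).

(* v_i; meaningful for i <= plen xi *)
Definition pvertex xi (i : nat) : vertex G :=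
  walk_end (pdata xi).1 (take i (pedges xi)).
Definition pstart xi : vertex G := pvertex xi 0.
Definition pfinish xi : vertex G := pvertex xi (plen xi).

(* xi_i is numbered from 1, while [onth] counts from 0; None when i is not in
   [1, plen xi]. *)
Definition pedge xi (i : nat) : option (edge G) :=
  if i is j.+1 then onth (pedges xi) j else None.

Lemma pcat_subproof xi eta : pfinish xi = pstart eta ->
  walk (pstart xi) (pedges xi ++ pedges eta).
Proof.
rewrite /pfinish /pstart /pvertex /plen take_size !take0 /= => h.
by rewrite walk_cat [walk_end _ [::]]/= h !pdataP.
Qed.

Definition pcat xi eta (h : pfinish xi = pstart eta) : gpath G :=
  @GPath R G (pstart xi, pedges xi ++ pedges eta) (pcat_subproof h).

Lemma psub_subproof xi i j : walk (pvertex xi i) (take (j - i) (drop i (pedges xi))).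
Proof.
have := pdataP xi; rewrite -[X in walk _ X](cat_take_drop i) walk_cat.
case/andP=> _; rewrite -[X in walk _ X](cat_take_drop (j - i)) walk_cat.
by case/andP.
Qed.

Definition psub xi (i j : nat) : gpath G :=
  @GPath R G (pvertex xi i, take (j - i) (drop i (pedges xi)))
    (psub_subproof xi i j).

Lemma preverse_subproof xi : walk (pfinish xi) (rev (map (@erev R G) (pedges xi))).
Proof.
by rewrite /pfinish /pvertex /plen take_size; exact/walk_rev/pdataP.
Qed.

Definition preverse xi : gpath G :=
  @GPath R G (pfinish xi, rev (map (@erev R G) (pedges xi))) (preverse_subproof xi).

End PathOps.

Section FGamma.
Context {R : realType} {G : graph R}.
Local Notation C := R[i].
(* F(Gamma); P_n(Gamma) is the span of the << xi >> with plen xi = n. *)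
Local Notation F := {malg C[gpath G]}.

Definition bullet (xi eta : gpath G) : F :=
  if pfinish xi =P pstart eta is ReflectT h then << pcat h >> else 0.

(* The map S^n_i on basis elements, extended by 0 to the P_m with m <> n. *)
Definition contract_basis (n i : nat) (xi : gpath G) : F :=
  if [&& plen xi == n, (1 <= i < n)%N &
         pedge xi i == omap (@erev R G) (pedge xi i.+1)]
  then (mu (pvertex xi i) / mu (pvertex xi i.+1))%:C%C *:
         bullet (psub xi 0 i.-1) (psub xi i.+1 n)
  else 0.

Definition contract (n i : nat) (x : F) : F :=
  \sum_(xi <- msupp x) x@_xi *: contract_basis n i xi.

(* The composite S_{m-k+1}^{m+n-2(k-1)} ... S_{m-1}^{m+n-2} S_m^{m+n} *)
Fixpoint contract_iter (m n k : nat) (x : F) : F :=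
  if k is k'.+1 then
    contract (m + n - 2 * k')%N (m - k')%N (contract_iter m n k' x) else x.

Definition fmul_basis (xi eta : gpath G) : F :=
  \sum_(0 <= k < (minn (plen xi) (plen eta)).+1)
     contract_iter (plen xi) (plen eta) k (bullet xi eta).

Definition fmul (x y : F) : F :=
  \sum_(xi <- msupp x) \sum_(eta <- msupp y)
     (x@_xi * y@_eta) *: fmul_basis xi eta.

Definition fstar (x : F) : F :=
  \sum_(xi <- msupp x) (x@_xi)^*%C *: << preverse xi >>.

Definition ftrace (x : F) : C :=
  \sum_(xi <- msupp x | plen xi == 0%N)
     x@_xi * (mu (pstart xi) ^+ 2)%:C%C.

End FGamma.

Record unital_assoc_star_algebra (C : numClosedFieldType) (A : lmodType C)
    (mul : A -> A -> A) (star : A -> A) : Prop := {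
  alg_linearl : forall y, linear (mul^~ y);
  alg_linearr : forall x, linear (mul x);
  alg_assoc : associative mul;
  alg_unital : exists e, left_id e mul /\ right_id e mul;
  star_conj_linear :
    forall (a : C) x y, star (a *: x + y) = Num.conj a *: star x + star y;
  star_involutive : involutive star;
  star_antimul : forall x y, star (mul x y) = mul (star y) (star x)
}.

Definition is_trace (C : numClosedFieldType) (A : lmodType C)
    (mul : A -> A -> A) (t : A -> C) : Prop :=
  scalar t /\ forall x y, t (mul x y) = t (mul y x).

(* In C, [0 <= z] says that z is real and nonnegative. *)
Definition positive_functional (C : numClosedFieldType) (A : lmodType C)
    (mul : A -> A -> A) (star : A -> A) (t : A -> C) : Prop :=
  forall x, 0 <= t (mul (star x) x).

Definition faithful_functional (C : numClosedFieldType) (A : lmodType C)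
    (mul : A -> A -> A) (star : A -> A) (t : A -> C) : Prop :=
  forall x, t (mul (star x) x) = 0 -> x = 0.

(* Main.v *)
(* On paths, the product obeys one recursion: if xi ends with e and eta starts
   with e', then xi # eta is the concatenation xi . eta plus, when e is the
   reverse of e', mu(f(e)) / mu(s(e)) times xi' # eta', where xi' and eta' drop
   the cancelled edges.  For a single edge e this gives (e # y) # z = e # (y # z)
   by induction on y; as e . xi is e # xi minus a multiple of a shorter path, left
   multiplications by edges generate all of them and associativity follows.
   The same recursion telescopes the weights in the trace:
   t(xi # eta) = mu(s(xi)) mu(f(xi)) if eta is the reverse of xi, and 0 otherwise.
   So the trace is symmetric and t(x^* # x) = sum |x_xi|^2 mu(s(xi)) mu(f(xi)). *)
Require Import Defs.
From HB Require Import structures.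
From mathcomp Require Import all_boot all_order all_algebra.
From mathcomp Require Import finmap reals complex.
From mathcomp.multinomials Require Import monalg.

Set Implicit Arguments.
Unset Strict Implicit.
Unset Printing Implicit Defensive.

Import Order.TTheory GRing.Theory Num.Theory.
Local Open Scope ring_scope.

(** * Extension of maps from a basis, linear up to an endomorphism of the scalars *)

Section TwistedLinear.
Context {K : choiceType} {C : nzRingType} {M : lmodType C}.
Context (sigma : {rmorphism C -> C}).
Implicit Types (h : K -> M) (x y : {malg C[K]}).

(** With [sigma] the identity this covers contractions, products and the trace; with [sigma] complex
    conjugation it covers the involution. *)
Definition malg_ext h x : M := \sum_(k <- msupp x) sigma x@_k *: h k.

Definition twisted_linear (f : {malg C[K]} -> M) :=
  forall a x y, f (a *: x + y) = sigma a *: f x + f y.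

(** Coefficients vanish off the support, so sums over different supports can be compared over one
    common finite set. *)
Lemma malg_extEw h x (d : {fset K}) : (msupp x `<=` d)%fset ->
  malg_ext h x = \sum_(k <- d) sigma x@_k *: h k.
Proof.
move=> sxd; apply: big_fset_incl => // k _ /mcoeff_outdom ->.
by rewrite rmorph0 scale0r.
Qed.

Lemma malg_ext_linear h : twisted_linear (malg_ext h).
Proof.
move=> a x y; pose d := (msupp x `|` msupp y `|` msupp (a *: x + y))%fset.
have [sx sy sz] : [/\ (msupp x `<=` d)%fset, (msupp y `<=` d)%fset &
    (msupp (a *: x + y) `<=` d)%fset].
  by split; apply/fsubsetP => k; rewrite !in_fsetU => ->; rewrite ?orbT.
rewrite (malg_extEw _ sx) (malg_extEw _ sy) (malg_extEw _ sz).
rewrite scaler_sumr -big_split /=; apply: eq_bigr => k _.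
by rewrite mcoeffD mcoeffZ rmorphD rmorphM scalerDl scalerA.
Qed.

Lemma malg_extU h k : malg_ext h << k >> = h k.
Proof.
by rewrite /malg_ext msuppU oner_eq0 big_seq_fset1 mcoeffUU rmorph1 scale1r.
Qed.

Lemma twisted_linear0 f : twisted_linear f -> f 0 = 0.
Proof.
move=> fL; have /eqP := fL 1 0 0.
by rewrite scale1r addr0 rmorph1 scale1r -subr_eq subrr eq_sym => /eqP.
Qed.

Lemma twisted_linearZ f a x : twisted_linear f -> f (a *: x) = sigma a *: f x.
Proof. by move=> fL; rewrite -[a *: x]addr0 fL twisted_linear0 ?addr0. Qed.

Lemma twisted_linearD f x y : twisted_linear f -> f (x + y) = f x + f y.
Proof. by move=> fL; rewrite -[x in LHS]scale1r fL rmorph1 scale1r. Qed.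

Lemma twisted_linear_sum f I (r : seq I) (F : I -> {malg C[K]}) :
  twisted_linear f ->
  f (\sum_(i <- r) F i) = \sum_(i <- r) f (F i).
Proof.
move=> fL; elim: r => [|i r IH]; first by rewrite !big_nil twisted_linear0.
by rewrite !big_cons twisted_linearD ?IH.
Qed.

Lemma eq_twisted_linear f g : twisted_linear f -> twisted_linear g ->
  (forall k, f << k >> = g << k >>) -> f =1 g.
Proof.
move=> fL gL fg x; rewrite (monalgE x) !twisted_linear_sum //.
apply: eq_bigr => k _.
(* [monalgE] leaves the coefficient inside the monomial; it must stand outside for [sigma] to act on
   it. *)
have -> : << x@_k *g k >> = x@_k *: << k >> :> {malg C[K]}.
  apply/malgP => k'; rewrite mcoeffZ !mcoeffU.
  by case: eqP; rewrite ?mulr1 ?mulr0n ?mulr0.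
by rewrite !twisted_linearZ ?fg.
Qed.

End TwistedLinear.

(* Sealed, like [gmul] below, as unification otherwise unfolds {malg C[K]}
   endlessly on terms that do not match; 0 when [p] is not a walk from [v]. *)
HB.lock Definition wordF (R : realType) (G : graph R) (v : vertex G)
    (p : seq (edge G)) : {malg R[i][gpath G]} :=
  if insub (v, p) is Some xi then << xi >> else 0.

(** * Paths as words, and the recursion that the product satisfies on them *)

Section Words.
Context {R : realType} {G : graph R}.
Local Notation V := (vertex G).
Local Notation E := (edge G).
Local Notation F := {malg R[i][gpath G]}.
Implicit Types (xi eta : gpath G) (v w : V) (p q r : seq E) (e : E).

Lemma wordF_gpath xi : << xi >> = wordF (pdata xi).1 (pedges xi).
Proof. by rewrite wordF.unlock /pedges -surjective_pairing valK. Qed.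

Lemma wordF_walk v p : walk v p ->
  exists2 xi, pdata xi = (v, p) & wordF v p = << xi >>.
Proof.
by move=> vp; exists (@GPath R G (v, p) vp) => //; rewrite wordF_gpath.
Qed.

Lemma wordF_nwalk v p : ~~ walk v p -> wordF v p = 0.
Proof. by move=> vp; rewrite wordF.unlock insubN. Qed.

(** The factor in S_i^n when [e] is the edge number i of a cancelling pair: v_i is the target of
    [e], and v_{i+1} = v_{i-1} is its source. *)
Definition edge_weight e : R[i] := (mu (etgt e) / mu (esrc e))%:C%C.

(* [rev r] and [q] are the edge sequences of the two factors, so the edges that
   may cancel are at the heads of [r] and [q]. *)
Fixpoint wmul v r q : F :=
  wordF v (rev r ++ q) +
  match r, q with
  | e :: r', e' :: q' =>
      if e == erev e' then edge_weight e *: wmul v r' q' else 0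
  | _, _ => 0
  end.

Lemma pstartE xi : pstart xi = (pdata xi).1.
Proof. by rewrite /pstart /pvertex take0. Qed.

Lemma pfinishE xi : pfinish xi = walk_end (pdata xi).1 (pedges xi).
Proof. by rewrite /pfinish /pvertex /plen take_size. Qed.

Lemma bulletE xi eta :
  bullet xi eta = if pfinish xi == pstart eta
    then wordF (pdata xi).1 (pedges xi ++ pedges eta) else 0.
Proof.
rewrite /bullet; case: (pfinish xi =P pstart eta) => [h|//].
by rewrite wordF_gpath /= pstartE.
Qed.

Lemma contract_linear n i : twisted_linear idfun (@contract R G n i).
Proof. exact: malg_ext_linear. Qed.

Lemma contractU n i xi : contract n i << xi >> = contract_basis n i xi.
Proof. exact: (malg_extU idfun). Qed.

Lemma contract_iter_linear m n k :
  twisted_linear idfun (@contract_iter R G m n k).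
Proof. by elim: k => [//|k IH] a x y /=; rewrite IH contract_linear. Qed.

(** The definition exposes the contraction applied last; the recursion on words needs the one
    applied first. What remains is the composite for two factors shortened by one edge each. *)
Lemma contract_iterS m n k (x : F) :
  contract_iter m.+1 n.+1 k.+1 x =
  contract_iter m n k (contract (m + n).+2 m.+1 x).
Proof.
have itS m' n' k' (y : F) : contract_iter m' n' k'.+1 y =
    contract (m' + n' - 2 * k')%N (m' - k')%N (contract_iter m' n' k' y) by [].
elim: k => [|k IH]; first by rewrite itS muln0 !subn0 addSn addnS.
rewrite itS IH [RHS]itS.
suff -> : (m.+1 + n.+1 - 2 * k.+1 = m + n - 2 * k)%N by [].
by rewrite addSn addnS mulnS -add2n subnDl.
Qed.

Lemma walk_end_rcons v p e : walk_end v (rcons p e) = etgt e.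
Proof. by rewrite /walk_end map_rcons last_rcons. Qed.

Lemma walk_end_cat v p q : walk_end v (p ++ q) = walk_end (walk_end v p) q.
Proof. by rewrite /walk_end map_cat last_cat. Qed.

Lemma contract_wordF v p q e e' :
  walk v (rcons p e ++ e' :: q) ->
  contract (size p + size q).+2 (size p).+1 (wordF v (rcons p e ++ e' :: q)) =
  if e == erev e' then edge_weight e *: wordF v (p ++ q) else 0.
Proof.
move=> wpq; have [xi xiE ->] := wordF_walk wpq.
have pE : pedges xi = rcons p e ++ e' :: q by rewrite /pedges xiE.
have d2 : drop (size p).+2 (pedges xi) = q.
  by rewrite pE -cat_rcons drop_size_cat ?size_rcons.
have t0 : take (size p) (pedges xi) = p.
  by rewrite pE cat_rcons take_size_cat.
have t1 : take (size p).+1 (pedges xi) = rcons p e.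
  by rewrite pE take_size_cat ?size_rcons.
have t2 : take (size p).+2 (pedges xi) = rcons (rcons p e) e'.
  by rewrite pE -cat_rcons take_size_cat ?size_rcons.
have e1 : pedge xi (size p).+1 = Some e.
  by rewrite /pedge pE cat_rcons onth_cat ltnn subnn.
have e2 : pedge xi (size p).+2 = Some e'.
  by rewrite /pedge pE onth_cat size_rcons ltnn subnn.
have len : plen xi = (size p + size q).+2.
  by rewrite /plen pE size_cat size_rcons /= addSn addnS.
rewrite contractU /contract_basis e1 e2 len eqxx /= leq_addr /=.
have -> : (Some e == Some (erev e')) = (e == erev e') by [].
case: eqP => [ee'|_]; last by [].
rewrite bulletE !pfinishE pstartE /= /pedges /= -/(pedges xi).
have st : pvertex xi 0 = v by rewrite /pvertex take0 xiE.
rewrite !subn0 drop0 t0 d2 st /pvertex t1 t2 !walk_end_rcons.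
rewrite subSS subSS addnC addnK take_size.
rewrite /edge_weight ee' esrc_erev.
(* The two remaining pieces do meet: [p] ends at the source of [e], which is the target of [e']. *)
move: wpq; rewrite cat_rcons walk_cat /= => /andP[_ /andP[/eqP <- _]].
by rewrite ee' esrc_erev eqxx.
Qed.

(** The term [k = 0] is the concatenation. All others begin with the same contraction at the
    junction, so together they are a weight times the sum for the shortened words, or vanish if the
    two edges do not cancel. *)
Lemma sum_contract_iter v r q :
  walk v (rev r ++ q) ->
  \sum_(0 <= k < (minn (size r) (size q)).+1)
     contract_iter (size r) (size q) k (wordF v (rev r ++ q)) = wmul v r q.
Proof.
elim: r q => [|e r IH] [|e' q] wrq;
  rewrite /= ?minn0 ?min0n ?big_nat1 ?addr0 //.
rewrite minnSS big_nat_recl //; congr (_ + _).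
rewrite rev_cons in wrq *.
under eq_bigr => k _.
  rewrite contract_iterS; have := contract_wordF wrq.
  rewrite size_rev => ->; over.
case: eqP => ee'; last first.
  rewrite big1 // => k _.
  exact: twisted_linear0 (contract_iter_linear _ _ _).
rewrite -IH ?scaler_sumr.
  apply: eq_bigr => k _; exact: twisted_linearZ (contract_iter_linear _ _ _).
move: wrq; rewrite cat_rcons !walk_cat /= => /andP[-> /andP[/eqP <- /andP[_]]].
by rewrite ee' esrc_erev.
Qed.

Lemma fmul_basisE xi eta :
  fmul_basis xi eta = if pfinish xi == pstart eta
    then wmul (pdata xi).1 (rev (pedges xi)) (pedges eta) else 0.
Proof.
rewrite /fmul_basis bulletE; case: eqP => [h|_]; last first.
  rewrite big1 // => k _.
  exact: twisted_linear0 (contract_iter_linear _ _ _).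
rewrite -sum_contract_iter revK ?size_rev //.
rewrite walk_cat -pfinishE h pstartE; apply/andP; split; exact: pdataP.
Qed.

Lemma fmulE (x y : F) :
  fmul x y = malg_ext idfun (fun xi => malg_ext idfun (fmul_basis xi) y) x.
Proof.
apply: eq_bigr => xi _; rewrite scaler_sumr; apply: eq_bigr => eta _.
by rewrite scalerA.
Qed.

Lemma fmul_linearl (y : F) : twisted_linear idfun (fmul^~ y).
Proof. by move=> a x x' /=; rewrite !fmulE malg_ext_linear. Qed.

Lemma fmul_linearr (x : F) : twisted_linear idfun (fmul x).
Proof.
move=> a y y'; rewrite !fmulE scaler_sumr -big_split; apply: eq_bigr => xi _.
by rewrite malg_ext_linear scalerDr !scalerA mulrC.
Qed.

Lemma fmulUU xi eta : fmul << xi >> << eta >> = fmul_basis xi eta.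
Proof. by rewrite fmulE !malg_extU. Qed.

End Words.

(** The generic induction step of [edge_wmul]: cancellations at the left and right ends of a middle
    word with at least two edges are independent, so they may be expanded in either order. *)
Lemma if_scale_exchange (A : comNzRingType) (M : lmodType A) (b c : bool)
    (k l : A) (x y z w : M) :
  x + (if b then k *: y else 0) +
    (if c then l *: (z + if b then k *: w else 0) else 0) =
  x + (if c then l *: z else 0) +
    (if b then k *: (y + if c then l *: w else 0) else 0).
Proof.
case: b; case: c; rewrite ?addr0 //.
by rewrite !scalerDr !scalerA [k * l]mulrC addrACA.
Qed.

HB.lock Definition gmul (R : realType) (G : graph R)
    (x y : {malg R[i][gpath G]}) := fmul x y.
Arguments gmul {R G} x y.

(** * Associativity, from left multiplication by vertices and edges *)

Section Associativity.
Context {R : realType} {G : graph R}.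
Local Notation V := (vertex G).
Local Notation E := (edge G).
Local Notation F := {malg R[i][gpath G]}.
Implicit Types (xi eta : gpath G) (v w : V) (p q r : seq E) (e : E).
Implicit Types (x y z : F).

Lemma gmul_linearl y : twisted_linear idfun (gmul^~ y).
Proof. rewrite gmul.unlock; exact: fmul_linearl. Qed.

Lemma gmul_linearr x : twisted_linear idfun (gmul x).
Proof. rewrite gmul.unlock; exact: fmul_linearr. Qed.

Lemma gmul0l y : gmul 0 y = 0.
Proof. exact: twisted_linear0 (gmul_linearl y). Qed.

Lemma gmul0r x : gmul x 0 = 0.
Proof. exact: twisted_linear0 (gmul_linearr x). Qed.

Lemma gmulDl x y z : gmul (x + y) z = gmul x z + gmul y z.
Proof. exact: twisted_linearD (gmul_linearl z). Qed.

Lemma gmulDr x y z : gmul x (y + z) = gmul x y + gmul x z.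
Proof. exact: twisted_linearD (gmul_linearr x). Qed.

Lemma gmulZl a x y : gmul (a *: x) y = a *: gmul x y.
Proof. exact: twisted_linearZ (gmul_linearl y). Qed.

Lemma gmulZr a x y : gmul x (a *: y) = a *: gmul x y.
Proof. exact: twisted_linearZ (gmul_linearr x). Qed.

Lemma gmulBl x y z : gmul (x - y) z = gmul x z - gmul y z.
Proof. by rewrite gmulDl -[- y]scaleN1r gmulZl scaleN1r. Qed.

Lemma gmul_wordF v p w q : walk v p -> walk w q ->
  gmul (wordF v p) (wordF w q) =
  if walk_end v p == w then wmul v (rev p) q else 0.
Proof.
move=> /wordF_walk[xi xiE ->] /wordF_walk[eta etaE ->].
by rewrite gmul.unlock fmulUU fmul_basisE pfinishE pstartE /pedges xiE etaE.
Qed.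

Lemma wmul0 v q : wmul v [::] q = wordF v q.
Proof. by rewrite /= addr0. Qed.

Lemma wmul_cons v e r e' q :
  wmul v (e :: r) (e' :: q) = wordF v (rev (e :: r) ++ e' :: q) +
    if e == erev e' then edge_weight e *: wmul v r q else 0.
Proof. by []. Qed.

Lemma wmulr0 v r : wmul v r [::] = wordF v (rev r).
Proof. by case: r => [|e r]; rewrite /= addr0 ?cats0. Qed.

Local Arguments wmul : simpl never.

Lemma wmul1 v e q : wmul v [:: e] q = wordF v (e :: q) +
  if q is e' :: q' then
    if e == erev e' then edge_weight e *: wordF v q' else 0
  else 0.
Proof.
case: q => [|e' q]; first by rewrite wmulr0 addr0.
by rewrite wmul_cons wmul0.
Qed.

Lemma edge_wordF e w q : gmul (wordF (esrc e) [:: e]) (wordF w q) =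
  if etgt e == w then wmul (esrc e) [:: e] q else 0.
Proof.
have [wq|nwq] := boolP (walk w q); first by rewrite gmul_wordF //= eqxx.
(* If [q] is not a walk from [w], the left side is zero, and for [etgt e = w] every word occurring
   on the right is a non-walk too. *)
rewrite (wordF_nwalk nwq) gmul0r; case: eqP => [ew|_]; last by [].
rewrite wmul1 wordF_nwalk; last by rewrite /= eqxx ew.
case: q nwq => [|e' q] nwq; first by [].
rewrite add0r; case: eqP => [ee'|_]; last by [].
rewrite wordF_nwalk ?scaler0 //; move: nwq.
by rewrite /= -ew ee' etgt_erev esrc_erev eqxx.
Qed.

(** This is [e # (p # q) = (e # p) # q] with [e # p] expanded. The induction removes the last edge
    of [p], because [p # q] cancels at the right end of [p] while [e] acts at its left end. *)
Lemma edge_wmul e p q :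
  gmul (wordF (esrc e) [:: e]) (wmul (etgt e) (rev p) q) =
  wmul (esrc e) (rev (e :: p)) q +
  if p is e' :: p' then
    if e == erev e' then edge_weight e *: wmul (esrc e) (rev p') q else 0
  else 0.
Proof.
elim/last_ind: p q => [|p g IH] q; first by rewrite wmul0 edge_wordF eqxx addr0.
case: q => [|h q].
  rewrite !wmulr0 !revK edge_wordF eqxx.
  rewrite wmul1; case: (rcons p g) => [|f p']; first by [].
  by rewrite wmulr0 revK.
rewrite -rcons_cons !rev_rcons wmul_cons gmulDr edge_wordF eqxx.
have -> : gmul (wordF (esrc e) [:: e]) (if g == erev h then
      edge_weight g *: wmul (etgt e) (rev p) q else 0) =
    if g == erev h then edge_weight g *:
      gmul (wordF (esrc e) [:: e]) (wmul (etgt e) (rev p) q) else 0.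
  by case: eqP => _; rewrite ?gmulZr ?gmul0r.
(* If the middle word is the single edge [g], both [e] and [h] compete for it; each side consists of
   the concatenation and these two cancellations, in different order. *)
rewrite IH wmul1; case: p {IH} => [|f p].
  have rev0 : rev (@nil E) = [::] by [].
  rewrite addr0 wmul_cons !rev_cons !rev0 /= wmul0; exact: addrAC.
rewrite wmul_cons !rcons_cons !(rev_cons g) !revK /= rev_rcons wmul_cons.
rewrite (rev_cons g) revK; exact: if_scale_exchange.
Qed.

Lemma vertex_wordF v w q :
  gmul (wordF v [::]) (wordF w q) = if v == w then wordF w q else 0.
Proof.
have [wq|nwq] := boolP (walk w q); last first.
  by rewrite (wordF_nwalk nwq) gmul0r; case: ifP.
rewrite gmul_wordF // wmul0 {1}/walk_end /=.
by case: eqP => [->|_]; last by [].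
Qed.

Lemma vertex_wmul v w r q :
  gmul (wordF v [::]) (wmul w r q) = if v == w then wmul w r q else 0.
Proof.
elim: r q => [|e r IH] q; first by rewrite wmul0 vertex_wordF.
case: q => [|e' q]; first by rewrite wmulr0 vertex_wordF.
rewrite wmul_cons gmulDr vertex_wordF.
have -> : gmul (wordF v [::])
      (if e == erev e' then edge_weight e *: wmul w r q else 0) =
    if e == erev e' then edge_weight e *:
      gmul (wordF v [::]) (wmul w r q) else 0.
  by case: (e == erev e'); rewrite ?gmulZr ?gmul0r.
rewrite IH; case: (v == w); first by [].
by rewrite scaler0 if_same addr0.
Qed.

(** Used with [L] a left multiplication, where the conclusion is associativity for that left
    factor. *)
Lemma linear_gmul_word (L : F -> F) : twisted_linear idfun L ->
  (forall v p w q, walk v p -> walk w q ->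
     L (gmul (wordF v p) (wordF w q)) = gmul (L (wordF v p)) (wordF w q)) ->
  forall x y, L (gmul x y) = gmul (L x) y.
Proof.
move=> Llin LE x y; move: x; apply: eq_twisted_linear.
- by move=> a x x'; rewrite gmul_linearl Llin.
- by move=> a x x'; rewrite Llin gmul_linearl.
move=> xi; move: y; apply: eq_twisted_linear => [a y y'|a y y'|eta].
- by rewrite gmul_linearr Llin.
- by rewrite gmul_linearr.
- by rewrite !wordF_gpath; apply: LE; exact: pdataP.
Qed.

Lemma vertex_assoc v x y :
  gmul (wordF v [::]) (gmul x y) = gmul (gmul (wordF v [::]) x) y.
Proof.
move: x y; apply: linear_gmul_word; first exact: gmul_linearr.
move=> w p u q wp uq; rewrite vertex_wordF (gmul_wordF wp uq).
have -> : gmul (if v == w then wordF w p else 0) (wordF u q) =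
    if v == w then gmul (wordF w p) (wordF u q) else 0.
  by case: (v == w); rewrite ?gmul0l.
rewrite (gmul_wordF wp uq); case: (_ == u); last by rewrite gmul0r if_same.
exact: vertex_wmul.
Qed.

Lemma edge_assoc e x y :
  gmul (wordF (esrc e) [:: e]) (gmul x y) =
  gmul (gmul (wordF (esrc e) [:: e]) x) y.
Proof.
move: x y; apply: linear_gmul_word; first exact: gmul_linearr.
move=> w p u q wp uq; rewrite edge_wordF.
case: (etgt e =P w) wp => [<-|ew] wp; last first.
  (* Here [e] does not end at [w], and every word in the expansion of the inner product starts at
     [w], so [e] kills each term. *)
  rewrite gmul0l (gmul_wordF wp uq); case: (_ == u); last by rewrite gmul0r.
  move: (rev p) => r; elim: r q {uq} => [|g r IH] q.
    by rewrite wmul0 edge_wordF; case: eqP.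
  case: q => [|h q]; first by rewrite wmulr0 edge_wordF; case: eqP.
  rewrite wmul_cons gmulDr edge_wordF; case: eqP => // _; rewrite add0r.
  by case: (g == erev h); rewrite ?gmulZr ?gmul0r // IH scaler0.
have eE : walk (esrc e) (e :: p) by rewrite /= eqxx.
rewrite (gmul_wordF wp uq) wmul1 gmulDl (gmul_wordF eE uq).
have -> : walk_end (esrc e) (e :: p) = walk_end (etgt e) p by [].
case: p wp eE => [|f p] wp eE.
  rewrite gmul0l addr0; case: (_ == u); last by rewrite gmul0r.
  by have := edge_wmul e [::] q; rewrite addr0.
(* After [e] and [f] cancel, [p] starts at the source of [e] and ends where [f :: p] did, so the
   test against [u] is unchanged. *)
have -> : gmul (if e == erev f then edge_weight e *: wordF (esrc e) p else 0)
    (wordF u q) =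
  if e == erev f then edge_weight e *:
    (if walk_end (etgt e) (f :: p) == u then wmul (esrc e) (rev p) q else 0)
  else 0.
  case: (e =P erev f) => [ef|_]; last by rewrite gmul0l.
  have tf : etgt f = esrc e by rewrite ef esrc_erev.
  have ep : walk (esrc e) p by move: wp; rewrite /= tf => /andP[].
  by rewrite gmulZl (gmul_wordF ep uq) /walk_end /= tf.
case: (_ == u); last by rewrite gmul0r scaler0 if_same addr0.
exact: edge_wmul.
Qed.

(** Membership in the left nucleus of the product. Its closure properties let it be filled up from
    vertices and edges. *)
Definition left_assoc x := forall y z, gmul x (gmul y z) = gmul (gmul x y) z.

Lemma left_assocM x y : left_assoc x -> left_assoc y -> left_assoc (gmul x y).
Proof. by move=> xA yA z t; rewrite -xA yA -xA xA. Qed.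

Lemma left_assocB x y : left_assoc x -> left_assoc y -> left_assoc (x - y).
Proof. by move=> xA yA z t; rewrite !gmulBl xA yA. Qed.

Lemma left_assocZ a x : left_assoc x -> left_assoc (a *: x).
Proof. by move=> xA y z; rewrite !gmulZl xA. Qed.

Lemma left_assoc0 : left_assoc 0.
Proof. by move=> y z; rewrite !gmul0l. Qed.

Lemma gmulA : associative (@gmul R G).
Proof.
(* A bound on the length is used for the induction because the correction term is two edges shorter
   than the path. *)
suff wordA n v p : (size p <= n)%N -> left_assoc (wordF v p).
  move=> x y z; move: x; apply: eq_twisted_linear.
  - by move=> a x x'; rewrite gmul_linearl.
  - by move=> a x x'; rewrite !gmul_linearl.
  by move=> xi; rewrite wordF_gpath; apply: wordA (leqnn _) _ _.
elim: n v p => [|n IH] v [|e p] pn; [exact: vertex_assoc | exfalso; done |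
  exact: vertex_assoc |].
have [wp|nwp] := boolP (walk v (e :: p)); last first.
  by rewrite (wordF_nwalk nwp); exact: left_assoc0.
have /andP[/eqP <- _] := wp; have := edge_wordF e (etgt e) p.
rewrite eqxx wmul1 => /esym /(canRL (addrK _)) ->.
apply: left_assocB; first by apply: left_assocM (edge_assoc e) (IH _ _ pn).
case: p pn {wp} => [|f p] pn; first exact: left_assoc0.
case: (e == erev f); last exact: left_assoc0.
by apply: left_assocZ; apply: IH; apply: ltnW.
Qed.

End Associativity.

(** * The unit, the involution and the trace *)

Section StarAndTrace.
Context {R : realType} {G : graph R}.
Local Notation V := (vertex G).
Local Notation E := (edge G).
Local Notation F := {malg R[i][gpath G]}.
Implicit Types (xi eta : gpath G) (v w : V) (p q r : seq E) (e : E).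
Implicit Types (x y z : F).

Local Arguments wmul : simpl never.

Lemma gmulUU xi eta : gmul << xi >> << eta >> =
  if pfinish xi == pstart eta
  then wmul (pdata xi).1 (rev (pedges xi)) (pedges eta) else 0.
Proof. by rewrite gmul.unlock fmulUU fmul_basisE. Qed.

Definition gone : F := \sum_v wordF v [::].

Lemma gmul1x : left_id gone gmul.
Proof.
apply: (@eq_twisted_linear _ _ _ idfun (gmul gone) id) => [|//|xi].
  exact: gmul_linearr.
rewrite wordF_gpath (twisted_linear_sum _ _ (gmul_linearl _)).
under eq_bigr do rewrite vertex_wordF.
by rewrite -big_mkcond big_pred1_eq.
Qed.

Lemma gmulx1 : right_id gone gmul.
Proof.
apply: (@eq_twisted_linear _ _ _ idfun (gmul^~ gone) id) => [|//|xi].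
  exact: gmul_linearl.
rewrite wordF_gpath (twisted_linear_sum _ _ (gmul_linearr _)).
under eq_bigr => v _ do rewrite gmul_wordF ?pdataP // wmulr0 revK eq_sym.
by rewrite -big_mkcond big_pred1_eq.
Qed.

Lemma fstar_linear : twisted_linear (@conjc R) (@fstar R G).
Proof. exact: malg_ext_linear. Qed.

Lemma fstarD x y : fstar (x + y) = fstar x + fstar y.
Proof. exact: twisted_linearD fstar_linear. Qed.

Lemma fstarZ a x : fstar (a *: x) = conjc a *: fstar x.
Proof. exact: twisted_linearZ fstar_linear. Qed.

Lemma fstarU xi : fstar << xi >> = << preverse xi >>.
Proof. exact: (malg_extU (@conjc R)). Qed.

Lemma walk_end_rev v p : walk v p ->
  walk_end (walk_end v p) (rev (map (@erev R G) p)) = v.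
Proof.
case: p => [//|e p] /= /andP[/eqP <- _].
by rewrite rev_cons walk_end_rcons etgt_erev.
Qed.

Lemma rev_map_erevK p : rev (map (@erev R G) (rev (map (@erev R G) p))) = p.
Proof. by rewrite map_rev revK (mapK (@erevK R G)). Qed.

Lemma preverseK : involutive (@preverse R G).
Proof.
move=> xi; apply: val_inj; rewrite /= pfinishE /= /pedges /= rev_map_erevK.
by rewrite pfinishE walk_end_rev ?pdataP // -surjective_pairing.
Qed.

Lemma pstart_reverse xi : pstart (preverse xi) = pfinish xi.
Proof. exact: pstartE. Qed.

Lemma pfinish_reverse xi : pfinish (preverse xi) = pstart xi.
Proof. by rewrite -pstart_reverse preverseK. Qed.

Lemma fstar_wordF v p : walk v p ->
  fstar (wordF v p) = wordF (walk_end v p) (rev (map (@erev R G) p)).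
Proof.
move=> /wordF_walk[xi xiE ->].
by rewrite fstarU wordF_gpath /pedges /= pfinishE /pedges xiE.
Qed.

Lemma conj_edge_weight e : conjc (edge_weight e) = edge_weight e.
Proof. exact: conjc_real. Qed.

(** Reversal exchanges the factors. As [wmul] reads both lists outwards from the junction, this just
    swaps them and reverses single edges; the same pairs cancel, with the same real weights. *)
Lemma fstar_wmul v r q : walk v (rev r) -> walk (walk_end v (rev r)) q ->
  fstar (wmul v r q) = wmul (walk_end (walk_end v (rev r)) q)
    (map (@erev R G) q) (map (@erev R G) r).
Proof.
elim: r q => [|e r IH] q.
  rewrite wmul0 wmulr0 => _ vq; exact: fstar_wordF.
rewrite rev_cons => wr; rewrite walk_end_rcons => wq.
case: q wq => [|e' q] wq.
  rewrite wmulr0 wmul0 rev_cons fstar_wordF // walk_end_rcons.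
  by rewrite -rev_cons map_rev revK.
rewrite wmul_cons fstarD.
rewrite wmul_cons rev_cons fstar_wordF; last first.
  by rewrite walk_cat wr walk_end_rcons.
rewrite walk_end_cat walk_end_rcons map_cat rev_cat -rev_cons map_rev revK.
congr (_ + _).
have -> : (erev e' == erev (erev e)) = (e == erev e').
  by rewrite erevK; apply/eqP/eqP => ->.
case: (e =P erev e') => [ee'|_]; last first.
  exact: (twisted_linear0 fstar_linear).
rewrite fstarZ conj_edge_weight.
move: wr wq; rewrite -cats1 walk_cat /= => /and3P[wr /eqP es _] /andP[_ wq].
have e't : etgt e' = walk_end v (rev r) by rewrite -es ee' esrc_erev.
rewrite IH; [|exact: wr|by rewrite -e't].
by rewrite -ee' -e't.
Qed.

Lemma fstarK : involutive (@fstar R G).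
Proof.
apply: (@eq_twisted_linear _ _ _ idfun (fun x => fstar (fstar x)) id).
- by move=> a x y; rewrite !fstarD !fstarZ conjcK.
- by [].
- by move=> xi; rewrite !fstarU preverseK.
Qed.

Lemma fstar_gmul x y : fstar (gmul x y) = gmul (fstar y) (fstar x).
Proof.
move: x; apply: (@eq_twisted_linear _ _ _ (@conjc R)).
- by move=> a x x' /=; rewrite gmul_linearl fstar_linear.
- by move=> a x x' /=; rewrite fstar_linear gmul_linearr.
move=> xi; move: y; apply: (@eq_twisted_linear _ _ _ (@conjc R)).
- by move=> a x x' /=; rewrite gmul_linearr fstar_linear.
- by move=> a x x' /=; rewrite fstar_linear gmul_linearl.
move=> eta; rewrite !fstarU !gmulUU.
rewrite pstart_reverse pfinish_reverse.
rewrite eq_sym; case: eqP => [ends|_]; last first.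
  exact: (twisted_linear0 fstar_linear).
have xP := pdataP xi; have eP := pdataP eta.
rewrite pstartE pfinishE in ends.
rewrite fstar_wmul ?revK -?/(pedges xi) -?ends //.
by rewrite /= pfinishE map_rev.
Qed.

(** [R[i]^o] is the field of scalars as a module over itself, which makes the extension results
    apply to functionals. *)
Lemma ftrace_linear : twisted_linear idfun (@ftrace R G : F -> R[i]^o).
Proof.
have trE x : @ftrace R G x = malg_ext idfun (fun xi =>
    if plen xi == 0%N then (mu (pstart xi) ^+ 2)%:C%C else 0 : R[i]^o) x.
  rewrite /ftrace big_mkcond; apply: eq_bigr => xi _.
  by case: ifP => _; rewrite ?scaler0.
by move=> a x y; rewrite !trE malg_ext_linear.
Qed.

Lemma ftrace0 : ftrace (0 : F) = 0.
Proof. exact: twisted_linear0 ftrace_linear. Qed.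

Lemma ftraceD x y : ftrace (x + y) = ftrace x + ftrace y.
Proof. exact: twisted_linearD ftrace_linear. Qed.

Lemma ftraceZ a x : ftrace (a *: x) = a * ftrace x.
Proof. exact: twisted_linearZ ftrace_linear. Qed.

Lemma ftrace_wordF v p : walk v p ->
  ftrace (wordF v p) = if p is [::] then (mu v ^+ 2)%:C%C else 0.
Proof.
move=> /wordF_walk[xi xiE ->].
rewrite /ftrace msuppU oner_eq0 big_mkcond big_seq_fset1 mcoeffUU mul1r.
by rewrite pstartE /plen /pedges xiE; case: (p).
Qed.

(** Non-empty words have trace zero, so only total cancellation survives. Cancelling [e] multiplies
    by mu(f(e))/mu(s(e)), which moves the second factor of the value from the source of [e] to its
    target. *)
Lemma ftrace_wmul v r q : walk v (rev r) -> walk (walk_end v (rev r)) q ->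
  ftrace (wmul v r q) =
  if q == map (@erev R G) r then (mu v * mu (walk_end v (rev r)))%:C%C else 0.
Proof.
elim: r q => [|e r IH] q.
  by rewrite wmul0 => _ vq; rewrite ftrace_wordF //; case: q vq.
rewrite rev_cons => wr; rewrite walk_end_rcons => wq.
case: q wq => [|e' q] wq.
  by rewrite wmulr0 rev_cons ftrace_wordF //; case: (rev r).
rewrite wmul_cons rev_cons ftraceD ftrace_wordF; last first.
  by rewrite walk_cat wr walk_end_rcons.
rewrite cat_rcons [map _ _]/= eqseq_cons.
have -> : (e' == erev e) = (e == erev e').
  by apply/eqP/eqP => ->; rewrite erevK.
rewrite (_ : match _ with [::] => _ | _ :: _ => 0 end = 0); last first.
  by case: (rev r).
rewrite add0r; case: (e =P erev e') => [ee'|_]; last exact: ftrace0.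
move: wr wq; rewrite -cats1 walk_cat /= => /and3P[wr /eqP es _] /andP[_ wq].
have e't : etgt e' = walk_end v (rev r) by rewrite -es ee' esrc_erev.
rewrite ftraceZ IH; [|exact: wr|by rewrite -e't].
case: eqP => _; last by rewrite mulr0.
rewrite -es /edge_weight -rmorphM; congr (_%:C%C).
by rewrite mulrCA -mulrA mulVf ?mulr1 // gt_eqF ?mu_gt0.
Qed.

Lemma ftrace_gmulUU xi eta : ftrace (gmul << xi >> << eta >>) =
  if eta == preverse xi then (mu (pstart xi) * mu (pfinish xi))%:C%C else 0.
Proof.
rewrite gmulUU; case: eqP => [ends|nends]; last first.
  (* The reverse of [xi] starts where [xi] finishes, so paths that do not compose are not mutually
     reverse. *)
  rewrite ftrace0; case: eqP => // eE; case: nends.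
  by rewrite eE pstart_reverse.
rewrite pstartE pfinishE in ends *.
have xP := pdataP xi; have eP := pdataP eta.
rewrite ftrace_wmul ?revK //; last by rewrite ends.
have -> : (eta == preverse xi) =
    (pedges eta == map (@erev R G) (rev (pedges xi))).
  rewrite -(inj_eq val_inj) /= pfinishE ends map_rev.
  by rewrite [pdata eta]surjective_pairing xpair_eqE eqxx.
by rewrite pstartE.
Qed.

(** On paths, being mutually reverse is a symmetric relation, and reversal only swaps the two
    factors of the weight. *)
Lemma ftrace_gmulC x y : ftrace (gmul x y) = ftrace (gmul y x).
Proof.
move: x; apply: (@eq_twisted_linear _ _ R[i]^o idfun).
- by move=> a x x' /=; rewrite gmul_linearl ftrace_linear.
- by move=> a x x' /=; rewrite gmul_linearr ftrace_linear.
move=> xi; move: y; apply: (@eq_twisted_linear _ _ R[i]^o idfun).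
- by move=> a x x' /=; rewrite gmul_linearr ftrace_linear.
- by move=> a x x' /=; rewrite gmul_linearl ftrace_linear.
move=> eta; rewrite !ftrace_gmulUU.
have -> : (xi == preverse eta) = (eta == preverse xi).
  by apply/eqP/eqP => ->; rewrite preverseK.
case: eqP => [->|_]; last by [].
rewrite pstart_reverse pfinish_reverse.
by rewrite mulrC.
Qed.

Definition pweight xi : R := mu (pstart xi) * mu (pfinish xi).

Lemma pweight_gt0 xi : 0 < pweight xi.
Proof. by rewrite mulr_gt0 ?mu_gt0. Qed.

(** Distinct paths are orthogonal for the form t(x^* # y), so pairing with [xi] extracts one
    coefficient. *)
Lemma ftrace_reverse_gmul xi y :
  ftrace (gmul << preverse xi >> y) = y@_xi * (pweight xi)%:C%C.
Proof.
move: y; apply: (@eq_twisted_linear _ _ R[i]^o idfun).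
- by move=> a x x' /=; rewrite gmul_linearr ftrace_linear.
- by move=> a x x' /=; rewrite mcoeffD mcoeffZ mulrDl -mulrA.
move=> eta; rewrite ftrace_gmulUU preverseK mcoeffU eq_sym.
case: eqP => [->|_]; last by rewrite mul0r.
rewrite mul1r /pweight pstart_reverse pfinish_reverse.
by rewrite mulrC.
Qed.

Lemma ftrace_fstar_gmul x : ftrace (gmul (fstar x) x) =
  \sum_(xi <- msupp x) (`|x@_xi| ^+ 2 * (pweight xi)%:C%C).
Proof.
rewrite {1}/fstar (twisted_linear_sum _ _ (gmul_linearl x)).
rewrite (twisted_linear_sum _ _ ftrace_linear).
apply: eq_bigr => xi _.
rewrite (twisted_linearZ _ _ (gmul_linearl x)) ftraceZ ftrace_reverse_gmul.
by rewrite mulrA [_ * x@_xi]mulrC -normCK.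
Qed.
End StarAndTrace.

Theorem proposition4 (R : realType) (G : graph R) :
  [/\ unital_assoc_star_algebra (@fmul R G) (@fstar R G),
      is_trace (@fmul R G) (@ftrace R G),
      positive_functional (@fmul R G) (@fstar R G) (@ftrace R G) &
      faithful_functional (@fmul R G) (@fstar R G) (@ftrace R G)].
Proof.
have -> : @fmul R G = gmul by rewrite gmul.unlock.
have term_ge0 (x : {malg R[i][gpath G]}) xi :
    0 <= `|x@_xi| ^+ 2 * (pweight xi)%:C%C.
  by rewrite mulr_ge0 ?exprn_ge0 // ler0c ltW ?pweight_gt0.
split.
- split.
  + by move=> y; exact: gmul_linearl.
  + by move=> x; exact: gmul_linearr.
  + exact: gmulA.
  + by exists gone; split; [exact: gmul1x | exact: gmulx1].
  + exact: fstar_linear.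
  + exact: fstarK.
  + exact: fstar_gmul.
- split; first exact: ftrace_linear.
  exact: ftrace_gmulC.
- move=> x; rewrite ftrace_fstar_gmul; apply: sumr_ge0 => xi _; exact: term_ge0.
(* A zero sum of non-negative terms has only zero terms. A path in the support would have a non-zero
   coefficient, forcing its positive weight to vanish. *)
- move=> x; rewrite ftrace_fstar_gmul big_seq_fsetE /= => /eqP.
  rewrite psumr_eq0 => [/allP x0|xi _]; last exact: term_ge0.
  apply/malgP => xi; rewrite mcoeff0; apply/eqP; rewrite mcoeff_eq0.
  apply/negP => xix; have := x0 [` xix]%fset (mem_index_enum _).
  rewrite /= mulf_eq0 expf_eq0 normr_eq0 mcoeff_eq0 xix /=.
  by move=> /eqP[w0]; have := pweight_gt0 xi; rewrite w0 ltxx.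
Qed.
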